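(* Let $(\mathcal{S},X,\Phi)$ be a dynamical system that is topologically transitive and non-minimal (i.e. not minimal), and assume that the set $\mathcal{M}$ of minimal points is dense in $X$. Then $(\mathcal{S},X,\Phi)$ is sensitive.
   Context: A dynamical system is a triplet $(\mathcal{S},X,\Phi)$ where $\mathcal{S}$ is a topological semigroup, $X$ is a metric space with metric $d$, and $\Phi:\mathcal{S}\times X\to X$ is a continuous function with $\Phi(s_1,\Phi(s_2,x))=\Phi(s_1s_2,x)$ for all $s_1,s_2\in\mathcal{S}$ and all $x\in X$. Write $\Phi_s(x)=\Phi(s,x)$. The orbit of $x\in X$ is $O(x)=\{\Phi_s(x): s\in\mathcal{S}\}$. A non-empty set $Y\subset X$ is minimal if $\overline{O(y)}=Y$ for every $y\in Y$. A point $x\in X$ is minimal if $\overline{O(x)}$ is compact and is a minimal set. $\mathcal{M}$ denotes the set of minimal points. The system is minimal if there exists a minimal point $x\in X$ with $\overline{O(x)}=X$. The system is topologically transitive if for all non-empty open sets $U,V\subset X$ there exists $s\in\mathcal{S}$ with $\Phi_s(U)\cap V\neq\emptyset$. The system is sensitive if there exists $\varepsilon>0$ such that for all $x\in X$ and all $\delta>0$ there exist $y\in B(x,\delta)$ (the ball of center $x$ and radius $\delta$) and $s\in\mathcal{S}$ such that $d(\Phi_s(x),\Phi_s(y))>\varepsilon$. *)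

(* Defs.v *)
From HB Require Import structures.
From mathcomp Require Import all_boot all_order all_algebra.
From mathcomp Require Import all_classical all_reals.
From mathcomp Require Import topology.

Set Implicit Arguments.
Unset Strict Implicit.
Unset Printing Implicit Defensive.

Import Order.TTheory GRing.Theory Num.Theory.

Local Open Scope classical_set_scope.
Local Open Scope ring_scope.

HB.structure Definition PreTopologicalSemigroup :=
  {S of Topological S & Semigroup S}.

HB.mixin Record PreTopologicalSemigroup_isTopologicalSemigroup S
    & PreTopologicalSemigroup S := {
  mulg_continuous : continuous (fun p : S * S => (p.1 * p.2)%g)
}.

#[short(type="topologicalSemigroupType")]
HB.structure Definition TopologicalSemigroup :=
  {S of PreTopologicalSemigroup S
      & PreTopologicalSemigroup_isTopologicalSemigroup S}.

(* A semigroup need not have an identity, so [x] need not belong to its own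
   orbit, nor to the closure of its orbit. *)
Record dynamicalSystem (R : realType) (S : topologicalSemigroupType)
    (X : metricType R) := DynamicalSystem {
  flow :> S * X -> X;
  flow_continuous : continuous flow;
  flowM : forall (s1 s2 : S) (x : X),
    flow (s1, flow (s2, x)) = flow ((s1 * s2)%g, x)
}.

Section DynamicalSystemDefs.
Context (R : realType) (S : topologicalSemigroupType) (X : metricType R).
Variable Phi : dynamicalSystem S X.

Definition flow_at (s : S) : X -> X := fun x => Phi (s, x).

Definition flow_orbit (x : X) : set X := [set flow_at s x | s in [set: S]].

Definition minimal_set (Y : set X) : Prop :=
  Y !=set0 /\ forall y, Y y -> closure (flow_orbit y) = Y.

Definition minimal_point (x : X) : Prop :=
  compact (closure (flow_orbit x)) /\ minimal_set (closure (flow_orbit x)).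

Definition minimal_points : set X := [set x | minimal_point x].

Definition minimal_system : Prop :=
  exists x, minimal_point x /\ closure (flow_orbit x) = [set: X].

Definition topologically_transitive : Prop :=
  forall U V : set X, open U -> U !=set0 -> open V -> V !=set0 ->
    exists s : S, (flow_at s @` U) `&` V !=set0.

Definition sensitive : Prop :=
  exists2 eps : R, 0 < eps &
    forall (x : X) (delta : R), 0 < delta ->
      exists2 y : X, ball x delta y &
        exists s : S, eps < mdist (flow_at s x) (flow_at s y).

End DynamicalSystemDefs.

(* Main.v *)
(** Non-minimality, transitivity and density of the minimal points provide two
    disjoint compact minimal sets, at distance at least [c > 0] from each other,
    so that every [x] is at distance at least [c / 2] from a minimal set [Y].
    Near [x] there is a point [p] lying in a compact minimal set [P].  By
    compactness, finitely many maps [f] suffice to bring every point of [P] back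
    near [x], and points close enough to [Y] remain close to [Y] under all these
    [f].  By transitivity some [u] near [x] is sent by some [t] that close to
    [Y]; choosing [f] such that [f t p] is near [x], the points [f t p] and
    [f t u] are far apart, hence one of them is far from [f t x]. *)

Require Import Defs.
From mathcomp Require Import all_boot all_order all_algebra.
From mathcomp Require Import all_classical all_reals.
From mathcomp Require Import topology lra.

Import Order.TTheory GRing.Theory Num.Theory.

Local Open Scope classical_set_scope.
Local Open Scope ring_scope.

(** Around each [k] in [K] a ball of radius [e] misses [L], so any [c < e / 2] is a gap valid on the
    ball of radius [e / 2]. Compactness, as near-covering along [c] tending to [0] from the right,
    lets one [c] serve all of [K]. *)
Lemma compact_closed_mdist_gap (R : realType) (X : metricType R)
    (K L : set X) :
  compact K -> closed L -> K `&` L = set0 ->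
  exists2 c : R, 0 < c & forall k l, K k -> L l -> c <= mdist k l.
Proof.
move=> Kc Lcl KL0.
have [c c0 KLc] : exists2 c : R, 0 < c &
    K `<=` [set k | forall l, L l -> c <= mdist k l].
  have /compact_near_coveringP/(_ _ (0^'+)
    (fun c : R => [set k | forall l, L l -> c <= mdist k l])) := Kc.
  have cov k : K k -> \forall k' \near k & c \near (0 : R)^'+,
      forall l, L l -> c <= mdist k' l.
    move=> Kk.
    have : nbhs k (~` L).
      apply: open_nbhs_nbhs; split; first exact: closed_openC.
      by move=> Lk; have : (K `&` L) k by []; rewrite KL0.
    move=> /nbhs_ballP[e /= e0 eL].
    exists (ball k (e / 2), [set c | c < e / 2]) => /=.
      by split; [apply: nbhsx_ballx | apply: nbhs_right_lt]; lra.
    move=> [k' c] /= []; rewrite ballEmdist/= => kk' ce l Ll.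
    rewrite leNgt; apply/negP => k'l; apply: (eL l) => //.
    by rewrite ballEmdist/=; have := metric_triangle k k' l; lra.
  move=> /(_ _ cov) KP; near ((0 : R)^'+) => c.
  by exists c; near: c => //; exact: nbhs_right_gt.
by exists c => // k l /KLc; exact.
Unshelve. all: by end_near. Qed.

Section MinimalSets.
Context {R : realType} {S : topologicalSemigroupType} {X : metricType R}.
Variable Phi : dynamicalSystem S X.
Implicit Types (x y : X) (Y Z U V : set X) (s : S).

Lemma flow_at_continuous s : continuous (flow_at Phi s).
Proof.
move=> x; apply: (@continuous_comp _ _ _ (fun y => (s, y)) Phi).
  by apply: cvg_pair; [exact: cvg_cst | exact: cvg_id].
exact: flow_continuous.
Qed.

Lemma flow_atM s t x : flow_at Phi s (flow_at Phi t x) = flow_at Phi (s * t)%g x.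
Proof. exact: flowM. Qed.

Lemma open_flow_at_preimage s U : open U -> open (flow_at Phi s @^-1` U).
Proof. by apply: open_comp => x _; exact: flow_at_continuous. Qed.

Lemma minimal_set_flow_at Y y s :
  minimal_set Phi Y -> Y y -> Y (flow_at Phi s y).
Proof. by move=> [_ Ymin] /Ymin <-; apply: subset_closure; exists s. Qed.

Lemma minimal_set_closed Y : minimal_set Phi Y -> closed Y.
Proof. by move=> [[y Yy] /(_ _ Yy) <-]; exact: closed_closure. Qed.

Lemma minimal_set_disjoint Y Z :
  minimal_set Phi Y -> minimal_set Phi Z -> Y <> Z -> Y `&` Z = set0.
Proof.
move=> [_ Ymin] [_ Zmin] YZ; apply/eqP/negPn/negP => /set0P[y [Yy Zy]].
by apply: YZ; rewrite -(Ymin _ Yy) (Zmin _ Zy).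
Qed.

Lemma minimal_set_visit Y y : minimal_set Phi Y -> Y y ->
  forall U, open U -> Y `&` U !=set0 -> exists s, U (flow_at Phi s y).
Proof.
move=> [_ Ymin] /Ymin YE U Uo [u [Yu Uu]].
have : closure (flow_orbit Phi y) u by rewrite YE.
by move=> /(_ U (open_nbhs_nbhs (conj Uo Uu)))[_ [[s _ <-] Us]]; exists s.
Qed.

(* Finitely many times suffice to bring all points of the compact set [Y] into
   [U], and each of these maps sends a neighborhood of [w] into [V]. *)
Lemma minimal_set_near_visit Y U V w : compact Y -> minimal_set Phi Y ->
  open U -> Y `&` U !=set0 -> open V -> (forall s, V (flow_at Phi s w)) ->
  \forall w' \near w, forall y, Y y ->
    exists s, U (flow_at Phi s y) /\ V (flow_at Phi s w').
Proof.
move=> /compact_near_coveringP Yc Ymin Uo YU Vo Vw.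
apply: (Yc _ (nbhs w) (fun w' => [set y | exists s,
  U (flow_at Phi s y) /\ V (flow_at Phi s w')])) => y Yy.
have [s Us] := minimal_set_visit _ _ Ymin Yy U Uo YU.
exists (flow_at Phi s @^-1` U, flow_at Phi s @^-1` V) => /=.
  by split; apply: open_nbhs_nbhs; split=> //; exact: open_flow_at_preimage.
by move=> [y' w'] /= [Uy' Vw']; exists s.
Qed.

Lemma transitive_visit U V : topologically_transitive Phi ->
  open U -> U !=set0 -> open V -> V !=set0 ->
  exists s, exists2 x, U x & V (flow_at Phi s x).
Proof.
move=> tr Uo U0 Vo V0; have [s [_ [[x Ux <-] Vx]]] := tr _ _ Uo U0 Vo V0.
by exists s, x.
Qed.

(* A minimal point need not lie in its orbit closure, so the open set is first
   shrunk to the points which some [s] sends back into it. *)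
Lemma open_meets_minimal_set U : topologically_transitive Phi ->
  dense (minimal_points Phi) -> open U -> U !=set0 ->
  exists2 Y, compact Y /\ minimal_set Phi Y & Y `&` U !=set0.
Proof.
move=> tr dM Uo U0; have [s [u Uu Usu]] := transitive_visit _ _ tr Uo U0 Uo U0.
have [|p [Up [Pc Pmin]]] := dM (flow_at Phi s @^-1` U) _
  (open_flow_at_preimage s U Uo); first by exists u.
exists (closure (flow_orbit Phi p)); first by [].
by exists (flow_at Phi s p); split=> //; apply: subset_closure; exists s.
Qed.

Lemma disjoint_minimal_sets x0 : topologically_transitive Phi ->
  ~ minimal_system Phi -> dense (minimal_points Phi) ->
  exists Y Z, [/\ compact Y, minimal_set Phi Y, minimal_set Phi Z
    & Y `&` Z = set0].
Proof.
move=> tr nmin dM.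
have [|p [_ [Pc Pmin]]] := dM setT _ openT; first by exists x0.
set P := closure _ in Pc Pmin.
have [[q [Qc Qmin] QP]|oneP] := pselect (exists2 q, minimal_point Phi q &
    closure (flow_orbit Phi q) <> P).
  exists P, (closure (flow_orbit Phi q)); split => //.
  by apply: minimal_set_disjoint => //; exact: nesym.
(* Otherwise every [flow_at s] maps the dense set of minimal points, hence all
   of [X], into [P], and no orbit reaches the complement of [P]. *)
have PC0 : ~` P !=set0.
  apply/set0P/eqP => PC0; apply: nmin; exists p; split=> //.
  by rewrite -/P -(setCK P) PC0 setC0.
have PCo : open (~` P) by apply: closed_openC; exact: minimal_set_closed Pmin.
have [s [x _ sxP]] := transitive_visit _ _ tr openT (ex_intro _ x0 I) PCo PC0.
have [|q [sqP qM]] := dM (flow_at Phi s @^-1` ~` P) _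
  (open_flow_at_preimage s _ PCo); first by exists x.
have [QP|QP] := pselect (closure (flow_orbit Phi q) = P).
  by case: sqP; rewrite -QP; apply: subset_closure; exists s.
by case: oneP; exists q.
Qed.

Lemma sensitive_away_from_minimal_set Y (c : R) x (delta : R) :
  topologically_transitive Phi -> dense (minimal_points Phi) ->
  minimal_set Phi Y -> 0 < c -> (forall y, Y y -> c <= mdist x y) ->
  0 < delta ->
  exists2 y, ball x delta y &
    exists s, c / 8 < mdist (flow_at Phi s x) (flow_at Phi s y).
Proof.
move=> tr dM Ymin c0 xY d0; have [[y0 Yy0] _] := Ymin.
(* The bound [delta] makes the points of [U] admissible; [c / 4] keeps returns to [U] close to
   [x]. *)
pose r := Num.min delta (c / 4).
have r0 : 0 < r by rewrite lt_min d0 divr_gt0.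
have rd : r <= delta by rewrite ge_min lexx.
have rc : r <= c / 4 by rewrite ge_min lexx orbT.
pose U := (ball x r)°.
have Uball : U `<=` ball x r by exact: interior_subset.
have Udelta : U `<=` ball x delta := subset_trans Uball (le_ball rd).
have Uo : open U by exact: open_interior.
have U0 : U !=set0 by exists x; exact: nbhsx_ballx.
have [P [Pc Pmin] PU] := open_meets_minimal_set U tr dM Uo U0.
have [p [Pp Up]] := PU.
pose V := \bigcup_(y in Y) (ball y (c / 4))°.
have Vo : open V by apply: bigcup_open => y _; exact: open_interior.
have Vy0 s : V (flow_at Phi s y0).
  exists (flow_at Phi s y0); first exact: minimal_set_flow_at.
  by apply: nbhsx_ballx; rewrite divr_gt0.
have W0 := minimal_set_near_visit P U V y0 Pc Pmin Uo PU Vo Vy0.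
have [t [u Uu Wtu]] := transitive_visit U _ tr Uo U0
  (open_interior _) (ex_intro _ y0 W0).
(* [f] is chosen after [t]: it returns the image of [p] under [t], still in [P], to [U]. *)
have [f] := interior_subset Wtu _ (minimal_set_flow_at _ _ t Pmin Pp).
rewrite !flow_atM => -[/Uball xp [y Yy /interior_subset yu]].
rewrite ballEmdist/= in xp; rewrite ballEmdist/= in yu.
have [lep|ltp] := leP (mdist (flow_at Phi (f * t)%g x)
    (flow_at Phi (f * t)%g p)) (c / 8); last first.
 by exists p; [exact: Udelta | exists (f * t)%g].
exists u; first by exact: Udelta.
exists (f * t)%g; move: xp yu lep.
move: (flow_at _ _ p) (flow_at _ _ u) (flow_at _ _ x) => a b z xa yb za.
(* Going from [x] to [y] through [a], [z] and [b] gives [mdist z b > c - c / 4 - c / 8 - c / 4],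
   which is [3 * c / 8]. *)
have := xY _ Yy.
have := metric_triangle x a y; have := metric_triangle a z y.
have := metric_triangle z b y; have := metric_sym b y.
have := metric_sym z a.
lra.
Qed.

End MinimalSets.

Theorem theorem1p1 (R : realType) (S : topologicalSemigroupType)
    (X : metricType R) (Phi : dynamicalSystem S X) :
  topologically_transitive Phi ->
  ~ minimal_system Phi ->
  dense (minimal_points Phi) ->
  sensitive Phi.
Proof.
move=> tr nmin dM.
have [[x0 _]|X0] := pselect (exists x : X, True); last first.
  (* In the empty space any positive constant works. *)
  by exists 1 => // x; case: X0; exists x.
have [Y [Z [Yc Ymin Zmin YZ0]]] := disjoint_minimal_sets Phi x0 tr nmin dM.
have [c c0 YZc] := compact_closed_mdist_gap _ _ _ _ Yc
  (minimal_set_closed Phi _ Zmin) YZ0.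
have c20 : 0 < c / 2 by rewrite divr_gt0.
exists (c / 2 / 8); first by rewrite divr_gt0.
move=> x delta d0.
have [xY|] := pselect (forall y, Y y -> c / 2 <= mdist x y).
  exact: (sensitive_away_from_minimal_set Phi Y).
(* Being within [c / 2] of a point of [Y], [x] is at least [c / 2] away from all of [Z]. *)
move=> /existsNP[y /not_implyP[Yy /negP]]; rewrite -ltNge => xy.
apply: (sensitive_away_from_minimal_set Phi Z) => // z Zz.
have := YZc _ _ Yy Zz; have := metric_triangle y x z; have := metric_sym y x.
lra.
Qed.
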